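(* Let $p$ be a prime, $n\ge 1$ an integer and $q=p^n$. Let $f:\mathbb{F}_q\to\mathbb{F}_q$ be a map of additive index $p^k$. Then $$\mathrm{w}(f)\le \begin{cases} n+1, & k=0,\\[4pt] \left(\dfrac{(n-k+1)^p-1}{n-k}\right)^k, & 1\le k<n.\end{cases}$$
   Context: Weight: every map $f:\mathbb{F}_q\to\mathbb{F}_q$ coincides on $\mathbb{F}_q$ with a unique polynomial $P_f\in\mathbb{F}_q[x]$ of degree at most $q-1$; the weight $\mathrm{w}(f)$ is the number of nonzero coefficients of $P_f$. Additive index: view $\mathbb{F}_q$ as an $n$-dimensional vector space over $\mathbb{F}_p$. A map $f:\mathbb{F}_q\to\mathbb{F}_q$ is of codimension at most $k$ ($0\le k\le n$) if there are an $\mathbb{F}_p$-linear map $M:\mathbb{F}_q\to\mathbb{F}_q$ (equivalently, a map induced by a linearised polynomial $\sum_j a_jX^{p^j}$, $a_j\in\mathbb{F}_q$) and an $\mathbb{F}_p$-subspace $U$ of $\mathbb{F}_q$ of dimension $n-k$ such that $f-M$ is constant on each coset of $U$. The codimension $\mathrm{codim}\, f$ is the smallest such $k$, and the additive index of $f$ is $\mathrm{AddInd}(f)=p^{\mathrm{codim}\, f}$. *)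

(* Defs.v *)
From HB Require Import structures.
From mathcomp Require Import all_boot all_order all_algebra all_field.
From mathcomp Require Import boolp.

Set Implicit Arguments.
Unset Strict Implicit.
Unset Printing Implicit Defensive.

Import GRing.Theory.
Local Open Scope ring_scope.

Section Weight.

Variable F : finFieldType.
Implicit Types (f : F -> F) (P : {poly F}).

Definition represents f : pred {poly F} :=
  fun P => (size P <= #|F|)%N && [forall x, P.[x] == f x].

Lemma represents_exists f : exists P, represents f P.
Proof.
exists (\sum_(a : F) f a *: (1 - ('X - a%:P) ^+ #|F|.-1)).
have F_gt1 : (1 < #|F|)%N := finNzRing_gt1 F.
apply/andP; split.
  apply: (leq_trans (size_sum _ _ _)); apply/bigmax_leqP => a _.
  apply: (leq_trans (size_scale_leq _ _)).
  apply: (leq_trans (size_polyD _ _)).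
  rewrite geq_max size_poly1 (ltnW F_gt1) size_polyN size_exp_XsubC.
  by rewrite (ltn_predK F_gt1) leqnn.
apply/forallP=> x; rewrite horner_sum (bigD1 x) //= big1 => [|a neq_ax].
  rewrite addr0 !hornerE subrr expr0n.
  by case: #|F| F_gt1 => [|[|m]] //= _; rewrite subr0 mulr1.
rewrite !hornerE; suff -> : (x - a) ^+ #|F|.-1 = 1 by rewrite subrr mulr0.
have nz : x - a != 0 by rewrite subr_eq0 eq_sym.
apply: (mulfI nz); rewrite -exprS (ltn_predK F_gt1) mulr1.
exact: expf_card.
Qed.

Lemma represents_unique f P Q : represents f P -> represents f Q -> P = Q.
Proof.
case/andP=> sP /forallP fP /andP[sQ /forallP fQ].
apply/eqP; rewrite -subr_eq0; apply: contraLR (leqnn #|F|) => nz.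
have rt : all (root (P - Q)) (enum F).
  apply/allP=> x _; rewrite /root hornerD hornerN.
  by rewrite (eqP (fP x)) (eqP (fQ x)) subrr.
have := max_poly_roots nz rt (enum_uniq F); rewrite -cardE => lt.
have := leq_trans lt (size_polyD _ _); rewrite size_polyN.
by move/leq_trans=> /(_ #|F|); rewrite geq_max sP sQ ltnn => /(_ isT).
Qed.

Definition poly_of f : {poly F} := xchoose (represents_exists f).

Definition weight f : nat := count (fun c => c != 0) (poly_of f).

End Weight.

Section AdditiveIndex.

Variables (F : finFieldType) (p : nat) (charF : p \in [pchar F]).

(* [V] is [F] itself, equipped with its structure of 'F_p-vector space. *)
Local Notation V := (pPrimeCharType charF).

Implicit Type f : V -> V.

Definition codim_at_most f (k : nat) : Prop :=
  (k <= \dim {:V})%N /\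
  exists (M : {linear V -> V}) (U : {vspace V}),
    \dim U = (\dim {:V} - k)%N /\
    forall x y : V, x - y \in U -> f x - M x = f y - M y.

Lemma codim_at_most_exists f : exists k, `[< codim_at_most f k >].
Proof.
exists (\dim {:V}); apply/asboolP; split=> //.
exists idfun, 0%VS; split; first by rewrite dimv0 subnn.
by move=> x y; rewrite memv0 subr_eq0 => /eqP ->.
Qed.

Definition codim f : nat := ex_minn (codim_at_most_exists f).

Definition additive_index f : nat := (p ^ codim f)%N.

End AdditiveIndex.

Arguments codim_at_most {F p} charF f k.
Arguments codim {F p} charF f.
Arguments additive_index {F p} charF f.

(* Main.v *)
(** Write f = M + g with M linear and g constant on the cosets of U, where
    dim U = m = n - k.  A nonzero linearised polynomial L of degree at most p^m
    vanishing on U has kernel exactly U, so L takes p^k values and g = h(L) for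
    some h of degree less than p^k.  For d = sum_i d_i p^i with d_i < p, L^d is
    the product over i < k of the (L^(p^i))^(d_i), and each L^(p^i) has only the
    m + 1 exponents p^i, ..., p^(i+m).  Hence the exponents of all the L^d lie
    in a set of size at most (sum_(e < p) (m + 1)^e)^k, which already contains the
    exponents p^j, j < n, of M. *)

Require Import Defs.
From HB Require Import structures.
From mathcomp Require Import all_boot all_order all_algebra all_field.

Set Implicit Arguments.
Unset Strict Implicit.
Unset Printing Implicit Defensive.

Import Order.TTheory GRing.Theory Num.Theory.
Local Open Scope ring_scope.

(** * Lists of exponents that contain the support of a polynomial *)

Section Supports.

Variable F : fieldType.
Implicit Types (P Q : {poly F}) (s t : seq nat).

Definition supported s P := forall i, P`_i != 0 -> i \in s.

(** Repetitions are kept, so the length is exactly a product; an upper bound on the support is all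
    that is wanted. *)
Definition sumset s t := [seq (a + b)%N | a <- s, b <- t].

Lemma size_sumset s t : size (sumset s t) = (size s * size t)%N.
Proof. exact: size_allpairs. Qed.

Lemma mem_sumset s t a b : a \in s -> b \in t -> (a + b)%N \in sumset s t.
Proof. by move=> sa tb; apply/allpairsP; exists (a, b). Qed.

Lemma supported_sub s t P : {subset s <= t} -> supported s P -> supported t P.
Proof. by move=> st sP i /sP/st. Qed.

Lemma supportedC c : supported [:: 0%N] c%:P.
Proof. by move=> i; rewrite coefC inE; case: (i == 0%N); rewrite ?eqxx. Qed.

Lemma supportedZ s c P : supported s P -> supported s (c *: P).
Proof.
move=> sP i; rewrite coefZ => nz; apply: sP.
by apply: contraNneq nz => ->; rewrite mulr0.
Qed.

Lemma supportedD s P Q : supported s P -> supported s Q -> supported s (P + Q).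
Proof.
move=> sP sQ i; rewrite coefD.
by have [->|/sP //] := eqVneq P`_i 0; rewrite add0r => /sQ.
Qed.

Lemma supported_sum (I : Type) (r : seq I) s (G : I -> {poly F}) :
  (forall i, supported s (G i)) -> supported s (\sum_(i <- r) G i).
Proof.
move=> sG; elim/big_ind: _ => [i|P Q|//]; first by rewrite coef0 eqxx.
exact: supportedD.
Qed.

Lemma supportedM s t P Q :
  supported s P -> supported t Q -> supported (sumset s t) (P * Q).
Proof.
move=> sP tQ i; rewrite coefM => nz.
have [j /andP[Pj Qj]|z] :=
  pickP (fun j : 'I_i.+1 => (P`_j != 0) && (Q`_(i - j) != 0)).
  rewrite -(subnKC (ltnSE (ltn_ord j))).
  by apply: mem_sumset; [apply: sP | apply: tQ].
move: nz; rewrite big1 ?eqxx // => j _; apply/eqP.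
by rewrite mulf_eq0 -[_ || _]negbK negb_or z.
Qed.

Lemma count_supported s P :
  supported s P -> (count (fun c => c != 0%R) P <= size s)%N.
Proof.
move=> sP; have -> : count (fun c => c != 0) P =
    size [seq i <- iota 0 (size P) | P`_i != 0].
  by rewrite size_filter -{1}[polyseq P](mkseq_nth 0) count_map.
apply: uniq_leq_size => [|i]; first by rewrite filter_uniq ?iota_uniq.
by rewrite mem_filter => /andP[/sP].
Qed.

End Supports.

(** * Exponents available to powers of a linearised polynomial *)

Section Exponents.

Variable p m : nat.

Definition frob_exps i := [seq (p ^ (i + r))%N | r <- iota 0 m.+1].

Definition power_exps i e := iter e (sumset (frob_exps i)) [:: 0%N].

Definition digit_exps i := flatten [seq power_exps i e | e <- iota 0 p].

Fixpoint comp_exps k :=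
  if k is k'.+1 then sumset (digit_exps k') (comp_exps k') else [:: 0%N].

Lemma size_power_exps i e : size (power_exps i e) = (m.+1 ^ e)%N.
Proof.
by elim: e => //= e IH; rewrite size_sumset IH size_map size_iota expnS.
Qed.

Lemma size_digit_exps i : size (digit_exps i) = (\sum_(e < p) m.+1 ^ e)%N.
Proof.
rewrite size_flatten /shape -map_comp sumnE big_map.
rewrite -(big_mkord xpredT (expn m.+1)).
by rewrite /index_iota subn0; apply: eq_bigr => e _ /=; rewrite size_power_exps.
Qed.

Lemma size_comp_exps k : size (comp_exps k) = ((\sum_(e < p) m.+1 ^ e) ^ k)%N.
Proof.
by elim: k => //= k IH; rewrite size_sumset IH size_digit_exps expnS.
Qed.

Lemma power_exps_digit i e :
  (e < p)%N -> {subset power_exps i e <= digit_exps i}.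
Proof.
move=> lt_ep a ea; apply/flattenP; exists (power_exps i e) => //.
by apply: map_f; rewrite mem_iota.
Qed.

Hypothesis p_gt1 : (1 < p)%N.

Lemma digit_exps0 i : 0%N \in digit_exps i.
Proof. by apply: (@power_exps_digit i 0 (ltnW p_gt1)); rewrite inE. Qed.

Lemma comp_exps0 k : 0%N \in comp_exps k.
Proof.
by elim: k => //= k IH; rewrite -[0%N]addn0 mem_sumset ?digit_exps0.
Qed.

Lemma frob_exps_digit i : {subset frob_exps i <= digit_exps i}.
Proof.
move=> a ia; apply: (@power_exps_digit i 1 p_gt1).
by rewrite -[a]addn0 mem_sumset.
Qed.

(** One digit equal to 1 and all others 0 give the exponents p^(i+r) with i < k and r <= m, and i +
    r takes every value below m + k. *)
Lemma comp_exps_pow k j :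
  (0 < k)%N -> (j < m + k)%N -> (p ^ j)%N \in comp_exps k.
Proof.
elim: k => // k IH _ lt_j /=.
have [le_kj|lt_jk] := leqP k j.
  rewrite -[(p ^ j)%N]addn0 mem_sumset ?comp_exps0 //; apply: frob_exps_digit.
  apply/mapP; exists (j - k)%N; rewrite ?subnKC // mem_iota add0n /=.
  by rewrite ltnS leq_subLR addnC -ltnS -addnS.
rewrite -[(p ^ j)%N]add0n mem_sumset ?digit_exps0 //.
by apply: IH; [apply: leq_ltn_trans lt_jk | apply: ltn_addl].
Qed.

End Exponents.

(** * Linearised polynomials and Moore matrices *)

Section Linearised.

Variables (F : fieldType) (p : nat).
Hypothesis charF : p \in [pchar F].

Let p_pr : prime p := pcharf_prime charF.
Let p_gt1 : (1 < p)%N := prime_gt1 p_pr.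

Definition linpoly r (c : 'rV[F]_r) : {poly F} :=
  \sum_(i < r) c 0 i *: 'X^(p ^ i).

Lemma exprD_Frobenius (R : comNzRingType) i (x y : R) : p \in [pchar R] ->
  (x + y) ^+ (p ^ i) = x ^+ (p ^ i) + y ^+ (p ^ i).
Proof.
move=> charR; apply: exprDn_pchar; rewrite pnatX; apply/orP; left.
by rewrite pnatE.
Qed.

Lemma sum_Frobenius (R : comNzRingType) i r (G : 'I_r -> R) : p \in [pchar R] ->
  (\sum_(j < r) G j) ^+ (p ^ i) = \sum_(j < r) G j ^+ (p ^ i).
Proof.
move=> charR; elim/big_rec2: _ => [|j _ y _ <-]; last exact: exprD_Frobenius.
by rewrite expr0n expn_eq0 eqn0Ngt prime_gt0.
Qed.

Lemma linpolyE r (c : 'rV[F]_r) x :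
  (linpoly c).[x] = \sum_(i < r) c 0 i * x ^+ (p ^ i).
Proof. by rewrite horner_sum; apply: eq_bigr => i _; rewrite !hornerE. Qed.

Lemma linpolyD r (c : 'rV[F]_r) : {morph horner (linpoly c) : x y / x + y}.
Proof.
move=> x y; rewrite !linpolyE -big_split /=; apply: eq_bigr => i _.
by rewrite exprD_Frobenius ?mulrDr.
Qed.

Lemma linpoly_eq0 r (c : 'rV[F]_r) : (linpoly c == 0) = (c == 0).
Proof.
apply/eqP/eqP => [z|->]; last first.
  by rewrite /linpoly big1 // => i _; rewrite mxE scale0r.
apply/rowP=> i; rewrite mxE -[RHS](coef0 F (p ^ i)) -z coef_sum (bigD1 i) //=.
rewrite coefZ coefXn eqxx mulr1 big1 ?addr0 // => j neq_ji.
by rewrite coefZ coefXn eqn_exp2l // val_eqE eq_sym (negPf neq_ji) mulr0.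
Qed.

Lemma size_linpoly r (c : 'rV[F]_r.+1) : (size (linpoly c) <= (p ^ r).+1)%N.
Proof.
apply: (leq_trans (size_sum _ _ _)); apply/bigmax_leqP => i _.
apply: (leq_trans (size_scale_leq _ _)); rewrite size_polyXn ltnS.
by rewrite leq_exp2l // -ltnS.
Qed.

Lemma supported_linpoly s r (c : 'rV[F]_r) :
  (forall i, (i < r)%N -> (p ^ i)%N \in s) -> supported s (linpoly c).
Proof.
move=> rs; apply: supported_sum => i; apply: supportedZ => j.
by rewrite coefXn; case: (eqVneq j) => [-> _|_ /eqP //]; apply: rs.
Qed.

(** Raising to the power p^i is additive on polynomials in characteristic p, so it acts on each
    monomial separately. *)
Lemma supported_linpolyX m (c : 'rV[F]_m.+1) i :
  supported (frob_exps p m i) (linpoly c ^+ (p ^ i)).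
Proof.
have charP : p \in [pchar {poly F}] by rewrite pchar_poly.
rewrite sum_Frobenius //; apply: supported_sum => r.
rewrite exprZn -exprM; apply: supportedZ => j.
rewrite coefXn -expnD addnC; case: (eqVneq j) => [-> _|_ /eqP //].
by apply/mapP; exists (val r); rewrite // mem_iota add0n /=; apply: ltn_ord.
Qed.

Lemma supported_linpoly_exp m (c : 'rV[F]_m.+1) k d :
  (d < p ^ k)%N -> supported (comp_exps p m k) (linpoly c ^+ d).
Proof.
elim: k d => [|k IH] d lt_d.
  by case: d lt_d => // _; rewrite expr0; apply: supportedC.
(* Split off the leading base-p digit of d; the remainder is below p^k and falls under the induction
   hypothesis. *)
rewrite (divn_eq d (p ^ k)) exprD mulnC exprM /=; apply: supportedM; last first.
  by apply: IH; rewrite ltn_mod expn_gt0 prime_gt0.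
have: (d %/ p ^ k < p)%N by rewrite ltn_divLR ?expn_gt0 ?prime_gt0 // -expnS.
move: (d %/ p ^ k)%N => e lt_ep.
apply: (@supported_sub _ (power_exps p m k e)); first exact: power_exps_digit.
elim: e {lt_ep} => [|e IHe]; first by rewrite expr0; apply: supportedC.
by rewrite exprS /=; apply: supportedM => //; apply: supported_linpolyX.
Qed.

Lemma supported_comp_linpoly m (c : 'rV[F]_m.+1) k (h : {poly F}) :
  (size h <= p ^ k)%N -> supported (comp_exps p m k) (h \Po linpoly c).
Proof.
move=> sh; rewrite comp_polyE; apply: supported_sum => d; apply: supportedZ.
exact: supported_linpoly_exp (leq_trans (ltn_ord d) sh).
Qed.

Definition moore_mx r d (b : 'I_d -> F) : 'M[F]_(r, d) :=
  \matrix_(i, j) b j ^+ (p ^ i).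

Lemma mulmx_moore r d (b : 'I_d -> F) (c : 'rV_r) :
  c *m moore_mx r b = \row_j (linpoly c).[b j].
Proof.
apply/rowP=> j; rewrite !mxE linpolyE; apply: eq_bigr => i _.
by rewrite mxE.
Qed.

(** The Moore matrix has more rows than columns, so its left kernel contains a nonzero coefficient
    vector. *)
Lemma linpoly_vanish_ex r d (b : 'I_d -> F) : (d < r)%N ->
  exists2 c : 'rV[F]_r, c != 0 & forall j, (linpoly c).[b j] = 0.
Proof.
move=> lt_dr; pose A := moore_mx r b; exists (nz_row (kermx A)).
  rewrite nz_row_eq0 kermx_eq0 /row_free neq_ltn.
  by rewrite (leq_ltn_trans (rank_leq_col A)).
move=> j; have /sub_kermxP := nz_row_sub (kermx A).
by rewrite mulmx_moore => /rowP/(_ j); rewrite !mxE.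
Qed.

End Linearised.

(** * The field as a vector space over its prime field *)

Section VectorSpace.

Variables (F : finFieldType) (p : nat) (charF : p \in [pchar F]).

Local Notation V := (pPrimeCharType charF).
Local Notation n := (\dim {:V}).

Let p_pr : prime p := pcharf_prime charF.
Let p_gt1 : (1 < p)%N := prime_gt1 p_pr.

Lemma card_pPrimeChar_vspace (U : {vspace V}) : #|U| = (p ^ \dim U)%N.
Proof. by rewrite card_vspace card_Fp. Qed.

Lemma card_pPrimeChar_dim : #|F| = (p ^ n)%N.
Proof. by rewrite -card_pPrimeChar_vspace card_vspacef. Qed.

Lemma dim_pPrimeChar_gt0 : (0 < n)%N.
Proof.
by have := finNzRing_gt1 F; rewrite card_pPrimeChar_dim; case: n.
Qed.

Lemma additive_vspace0 (U : {vspace V}) (g : V -> V) :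
  {morph g : x y / x + y} -> (forall j : 'I_(\dim U), g (vbasis U)`_j = 0) ->
  forall x, x \in U -> g x = 0.
Proof.
move=> gD g0 x Ux; have g00 : g 0 = 0.
  by apply: (addrI (g 0)); rewrite -gD !addr0.
have gMn y k : g (y *+ k) = g y *+ k.
  by elim: k => [|k IH]; rewrite ?mulr0n // !mulrS gD IH.
rewrite (coord_vbasis Ux); elim/big_rec: _ => // j y _ gy0.
rewrite gD gy0 addr0.
(* Scalars of the prime field act as natural multiples, so additivity of g already gives
   linearity. *)
have -> (a : 'F_p) (z : V) : a *: z = z *+ a by apply: mulr_natl.
by rewrite gMn g0 mul0rn.
Qed.

Lemma linpoly_kernel (U : {vspace V}) :
  exists2 c : 'rV[F]_(\dim U).+1, c != 0 &
    forall x, root (linpoly p c) x = (x \in U).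
Proof.
have [c nz_c c0] :=
  linpoly_vanish_ex p (fun j => (vbasis U)`_j : F) (ltnSn (\dim U)).
exists c => //.
have rootU x : x \in U -> root (linpoly p c) x.
  move=> Ux; apply/eqP.
  exact: (@additive_vspace0 U (horner (linpoly p c)) (linpolyD charF c)).
move=> x; apply/idP/idP => [Rx|/rootU //]; apply: contraT => notUx.
have nz : linpoly p c != 0 by rewrite linpoly_eq0.
(* A root outside [U] would make p^(dim U) + 1 roots, more than the degree allows. *)
have := max_poly_roots (rs := x :: enum U) nz.
rewrite /= Rx mem_enum notUx enum_uniq.
have -> : all (root (linpoly p c)) (enum U).
  by apply/allP => y; rewrite mem_enum => /rootU.
move=> /(_ isT isT); rewrite -cardE card_pPrimeChar_vspace => lt_s.
by have := leq_trans lt_s (size_linpoly charF c); rewrite ltnn.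
Qed.

(** The Moore matrix of a basis is invertible: a left kernel vector gives a linearised polynomial of
    degree at most p^(n-1) with q roots. Solving the resulting system matches M on the basis, hence
    everywhere. *)
Lemma linear_linpoly (M : {linear V -> V}) :
  exists c : 'rV[F]_n, forall x, (linpoly p c).[x] = M x.
Proof.
pose b (j : 'I_n) : F := (vbasis {:V})`_j; pose A := moore_mx p n b.
have vanish0 (c : 'rV[F]_n) : c *m A = 0 -> c = 0.
  rewrite mulmx_moore => /rowP c0; apply/eqP; rewrite -(linpoly_eq0 charF).
  apply: contraT => nz.
  have rt : all (root (linpoly p c)) (enum F).
    apply/allP => x _; apply/eqP.
    apply: (@additive_vspace0 {:V} (horner (linpoly p c))) => [|j|].
    - exact: linpolyD.
    - by have := c0 j; rewrite !mxE.
    - exact: memvf.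
  have := max_poly_roots nz rt (enum_uniq F).
  rewrite -cardE card_pPrimeChar_dim.
  move: dim_pPrimeChar_gt0 c {c0 nz rt}; case: n => // r _ c.
  move=> lt_s; have := leq_trans lt_s (size_linpoly charF c).
  by rewrite ltnS leq_exp2l // ltnn.
have uA : A \in unitmx.
  by rewrite -row_free_unit -kermx_eq0; apply/rowV0P => v /sub_kermxP/vanish0.
exists ((\row_j M (b j)) *m invmx A) => x.
apply/eqP; rewrite -subr_eq0; apply/eqP.
apply: (@additive_vspace0 {:V} (fun x => (linpoly p _).[x] - M x)) => [y z|j|].
- by rewrite linpolyD // raddfD opprD addrACA.
- apply/eqP; rewrite subr_eq0; apply/eqP.
  have := mulmx_moore p b ((\row_j M (b j)) *m invmx A).
  by rewrite mulmxKV // => /rowP/(_ j); rewrite !mxE.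
- exact: memvf.
Qed.

(** The fibres of L are the cosets of [U], so g factors through L, and it suffices to interpolate on
    the image of L. *)
Lemma linpoly_fibre_interp (U : {vspace V}) r (c : 'rV[F]_r) (g : V -> V) :
    (forall x, root (linpoly p c) x = (x \in U)) ->
    (forall x y, x - y \in U -> g x = g y) ->
  exists2 h : {poly F}, (size h <= p ^ (n - \dim U))%N &
    forall x, (h \Po linpoly p c).[x] = g x.
Proof.
move=> kerL gU; pose L := horner (linpoly p c).
have LB x y : (L x == L y) = (x - y \in U).
  rewrite -kerL /root -[L x](subrK (L y)).
  rewrite -{1}[x](subrK y) [L (_ + _)]linpolyD // addrK.
  by rewrite -[X in _ == X]add0r (inj_eq (addIr _)).
pose Im := [set L x | x : F].
have cardIm : #|Im| = (p ^ (n - \dim U))%N.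
  apply/eqP.
  rewrite -(eqn_pmul2r (_ : 0 < p ^ \dim U)%N) ?expn_gt0 ?prime_gt0 //.
  rewrite -expnD subnK ?dimvS ?subvf // -card_pPrimeChar_dim.
  (* Count [F] fibre by fibre: each fibre is a translate x + U. *)
  rewrite -[#|F|]sum1_card (partition_big_imset L) /= -sum_nat_const.
  apply/eqP/eq_bigr => _ /imsetP[x _ ->].
  rewrite sum1dep_card -card_pPrimeChar_vspace.
  rewrite -(card_imset _ (addrI x : injective (+%R x))).
  apply: eq_card => y; rewrite inE LB; apply/imsetP/idP => [[u Uu ->]|Uy].
    by rewrite addrAC subrr add0r.
  by exists (y - x); rewrite // addrC subrK.
(* Any preimage gives the same value of g; 0 is the default off the image. *)
pose gbar y := if [pick x | L x == y] is Some x then g x else 0.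
have gbarL x : gbar (L x) = g x.
  rewrite /gbar; case: pickP => [y|/(_ x)]; last by rewrite eqxx.
  by rewrite LB => /gU.
have [R /andP[_ /forallP Rg]] := represents_exists (gbar : F -> F).
(* Reduction modulo Z keeps the values on the image and brings the size down to at most its
   cardinality. *)
pose Z := \prod_(y <- enum Im) ('X - y%:P); exists (R %% Z) => [|x].
  have nzZ : Z != 0 by apply/monic_neq0/monic_prod_XsubC.
  have := ltn_modp R Z; rewrite nzZ size_prod_XsubC -cardE cardIm ltnS.
  by [].
have /eqP Z0 : root Z (L x) by rewrite root_prod_XsubC mem_enum imset_f.
rewrite horner_comp -[(linpoly p c).[x]]/(L x) -gbarL -(eqP (Rg (L x))).
by rewrite [in RHS](divp_eq R Z) hornerD hornerM Z0 mulr0 add0r.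
Qed.

End VectorSpace.

(** * From exponent lists to the weight bound *)

Lemma weight_supported (F : finFieldType) (f : F -> F) (P : {poly F}) s :
  represents f P -> supported s P -> (weight f <= size s)%N.
Proof.
move=> fP sP; rewrite /weight.
have -> : poly_of f = P.
  by apply: represents_unique fP; apply: (xchooseP (represents_exists f)).
exact: count_supported.
Qed.

(** The list [s] is left free because for k = 0 the list [comp_exps] is just [:: 0], which misses
    the exponents of M. *)
Lemma weight_codim_at_most (F : finFieldType) p (charF : p \in [pchar F])
    (f : F -> F) k s (n := \dim {:pPrimeCharType charF}) :
  codim_at_most charF f k ->
  (forall i, (i < n)%N -> (p ^ i)%N \in s) ->
  {subset comp_exps p (n - k) k <= s} -> (weight f <= size s)%N.
Proof.
have p_pr := pcharf_prime charF.
have p_gt1 := prime_gt1 p_pr.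
case=> le_kn [M [U [dimU fM]]] sM sU.
have [d dM] := linear_linpoly M.
have [c _ kerc] := linpoly_kernel U.
have [h sh hc] := linpoly_fibre_interp kerc fM.
move: c sh kerc hc; rewrite dimU -/n subKn // => c sh kerc hc.
apply: (@weight_supported _ _ (linpoly p d + (h \Po linpoly p c))); last first.
  apply: supportedD; first exact: supported_linpoly.
  exact: supported_sub sU (supported_comp_linpoly charF sh).
apply/andP; split; last first.
  by apply/forallP => x; rewrite hornerD dM hc addrC subrK.
(* The sum represents f only if its degree is below q: M contributes at most p^(n-1), the
   composition at most (p^k - 1) p^(n-k). *)
rewrite (card_pPrimeChar_dim charF) -/n.
apply: (leq_trans (size_polyD _ _)); rewrite geq_max; apply/andP; split.
  have := dim_pPrimeChar_gt0 charF; rewrite -/n.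
  move: d {dM}; rewrite -/n.
  case: n {dimU sM sU c sh kerc hc le_kn} => // r d _.
  by apply: (leq_trans (size_linpoly charF d)); rewrite ltn_exp2l.
apply: (leq_trans (size_comp_poly_leq _ _)).
apply: (@leq_ltn_trans ((p ^ k).-1 * p ^ (n - k))).
  apply: leq_mul; first by rewrite -!subn1 leq_sub2r.
  by rewrite -subn1 leq_subLR add1n size_linpoly.
rewrite -[X in (_ < p ^ X)%N](subnKC le_kn).
rewrite expnD ltn_pmul2r ?expn_gt0 ?prime_gt0 //.
by rewrite ltn_predL expn_gt0 prime_gt0.
Qed.

Unset Implicit Arguments.

Theorem theorem4 (p n : nat) (pr_p : prime p) (n_ge1 : (1 <= n)%N)
    (F : finFieldType) (cardF : #|F| = (p ^ n)%N) (f : F -> F) (k : nat)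
    (fk : additive_index (card_finPcharP cardF pr_p) f = (p ^ k)%N) :
  (k = 0%N -> (weight f <= n + 1)%N) /\
  ((1 <= k < n)%N ->
     (weight f)%:R <=
       ((((n - k + 1)%N%:R ^+ p - 1) / (n - k)%N%:R) ^+ k : rat)).
Proof.
have p_gt1 := prime_gt1 pr_p; set charF := card_finPcharP cardF pr_p in fk.
have dimF : \dim {:pPrimeCharType charF} = n.
  by apply: (expnI p_gt1); rewrite -card_pPrimeChar_dim.
have fk' : codim_at_most charF f k.
  have -> : k = codim charF f by apply: (expnI p_gt1); rewrite -fk.
  by rewrite /codim; case: ex_minnP => j /boolp.asboolP.
split=> [k0|/andP[k_gt0 lt_kn]].
  (* For k = 0, f - M is constant, which adds only the exponent 0. *)
  pose s := 0%N :: [seq (p ^ i)%N | i <- iota 0 n].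
  have := weight_codim_at_most (s := s) fk'.
  rewrite /= size_map size_iota dimF addn1; apply=> [i lt_in|i].
    by rewrite inE map_f ?orbT // mem_iota.
  by rewrite k0 !inE => ->.
have le_w : (weight f <= (\sum_(e < p) (n - k).+1 ^ e) ^ k)%N.
  rewrite -size_comp_exps; apply: (weight_codim_at_most fk'); rewrite dimF //.
  by move=> i lt_in; rewrite comp_exps_pow // subnK // ltnW.
apply: (le_trans (y := (((\sum_(e < p) (n - k).+1 ^ e) ^ k)%N%:R))).
  by rewrite ler_nat.
(* The quotient is the geometric sum of ratio n - k + 1; k < n makes its denominator nonzero. *)
have nz : (n - k)%N%:R != 0 :> rat by rewrite pnatr_eq0 subn_eq0 -ltnNge.
rewrite natrX subrX1 addn1 -[X in X - 1]natr1 addrK mulrAC divff // mul1r.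
by rewrite natr_sum; under eq_bigr do rewrite natrX.
Qed.
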